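(* For any non-trivial rail arc $r$, i.e. any rail arc $r$ that is not rail isotopic into a plane, $$4\le s[r],$$ where $s[r]$ denotes the stick number of the rail arc class $[r]$ of $r$.
   Context: Everything is in the piecewise linear category. Let $\ell_1,\ell_2\subset\mathbb{R}^3$ be two parallel lines, called rails. A rail arc is an embedding of a simple arc $r$ in $\mathbb{R}^3$ with one endpoint on $\ell_1$, the other on $\ell_2$, and interior disjoint from $\ell_1\cup\ell_2$. Two rail arcs are rail isotopic if there is an ambient isotopy of $\mathbb{R}^3$ taking one to the other while mapping each rail onto itself throughout the isotopy. A rail arc class $[r]$ is a rail isotopy class of rail arcs. It is trivial if it has a representative contained in a plane; equivalently, if it has a representative whose projection to a plane perpendicular to the rails is an embedded arc. A stick rail arc is a rail arc that is a finite union of line segments, called sticks. The stick number $s[r]$ of a rail arc class $[r]$ is the minimum number of sticks needed to create a stick rail arc representing $[r]$. *)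

(* Defs.v *)
From HB Require Import structures.
From mathcomp Require Import all_boot all_order all_algebra.
From mathcomp Require Import all_classical all_reals all_analysis.
Set Implicit Arguments.
Unset Strict Implicit.
Unset Printing Implicit Defensive.
Import Order.TTheory GRing.Theory Num.Theory.
Import numFieldNormedType.Exports.
Local Open Scope classical_set_scope.
Local Open Scope ring_scope.

Section PiecewiseLinear.
Context (R : realType) (V W : normedModType R).

Definition convex_polyhedron (P : set V) : Prop :=
  exists (k : nat) (phi : 'I_k -> {linear V -> R^o}) (b : 'I_k -> R),
    P = [set x | forall i, phi i x <= b i].

Definition affine_on (P : set V) (f : V -> W) : Prop :=
  exists (L : {linear V -> W}) (c : W), forall x, P x -> f x = L x + c.

(* Piecewise linearity on a possibly noncompact polyhedron D, hence the
   requirement is local: only finitely many affine pieces near each point.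
   Polyhedra are closed in finite dimension, so continuity on D follows.
   Below, D is always a convex polyhedron of a finite-dimensional space. *)
Definition pl_on (D : set V) (f : V -> W) : Prop :=
  forall x, D x -> exists (n : nat) (P : 'I_n -> set V),
    [/\ forall i, convex_polyhedron (P i),
        forall i, affine_on (D `&` P i) f
      & \forall y \near x, D y -> exists i, P i y].

End PiecewiseLinear.

Section RailArcs.
Context (R : realType).
Local Notation E3 := 'rV[R]_3.

Definition unit_interval : set R^o := [set t : R | 0 <= t <= 1].

Definition line (a d : E3) : set E3 := [set a + t *: d | t in [set: R]].

Definition segment (a b : E3) : set E3 :=
  [set (1 - t) *: a + t *: b | t in unit_interval].

Definition plane (P : set E3) : Prop :=
  exists (n : 'cV[R]_3) (c : R), n != 0 /\ P = [set x | (x *m n) 0 0 = c].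

Definition rails (l1 l2 : set E3) : Prop :=
  exists a b d : E3,
    [/\ d != 0, l1 = line a d, l2 = line b d & l1 <> l2].

(* The level-preserving map (x, t) |-> (H t x, t) is a PL homeomorphism of
   R^3 x [0, 1]; the inverse level maps are the G t. *)
Definition ambient_isotopy (H : R -> E3 -> E3) : Prop :=
  let D : set (E3 * R^o) := [set p | unit_interval p.2] in
  [/\ pl_on D (fun p => H p.2 p.1),
      H 0 =1 id
    & exists2 G : R -> E3 -> E3, pl_on D (fun p => G p.2 p.1) &
        forall t, unit_interval t -> cancel (H t) (G t) /\ cancel (G t) (H t)].

Definition rail_isotopic (l1 l2 r r' : set E3) : Prop :=
  exists H : R -> E3 -> E3,
    [/\ ambient_isotopy H,
        forall t, unit_interval t -> H t @` l1 = l1 /\ H t @` l2 = l2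
      & H 1 @` r = r'].

(* A rail arc is identified with its image. *)
Definition rail_arc (l1 l2 r : set E3) : Prop :=
  exists g : R^o -> E3,
    [/\ pl_on unit_interval g, {in unit_interval &, injective g},
        r = g @` unit_interval,
        l1 (g 0) /\ l2 (g 1)
      & forall t : R, 0 < t < 1 -> ~ l1 (g t) /\ ~ l2 (g t)].

Definition rail_arc_class (l1 l2 r : set E3) : set (set E3) :=
  [set r' | rail_arc l1 l2 r' /\ rail_isotopic l1 l2 r r'].

Definition trivial_class (C : set (set E3)) : Prop :=
  exists2 r, C r & exists2 P, plane P & r `<=` P.

Definition union_of_sticks (n : nat) (r : set E3) : Prop :=
  exists a b : 'I_n -> E3,
    (forall i, a i != b i) /\ r = \bigcup_i segment (a i) (b i).

Definition representable_by_sticks (C : set (set E3)) (n : nat) : Prop :=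
  exists2 r, C r & union_of_sticks n r.

(* The default value 0 is never used for a rail arc class: a PL arc is a
   finite union of segments. *)
Definition stick_number (C : set (set E3)) : nat :=
  if pselect (exists n, `[< representable_by_sticks C n >]) is left h
  then ex_minn h else 0%N.

End RailArcs.

(* Main.v *)
Require Import Defs.
From HB Require Import structures.
From mathcomp Require Import all_boot all_order all_algebra.
From mathcomp Require Import all_classical all_reals all_analysis.
From mathcomp Require Import ring lra.
Set Implicit Arguments.
Unset Strict Implicit.
Unset Printing Implicit Defensive.
Import Order.TTheory GRing.Theory Num.Theory.
Import numFieldNormedType.Exports.
Local Open Scope classical_set_scope.
Local Open Scope ring_scope.

(** Why three sticks never suffice.

    A rail arc made of at most three sticks follows a path [A B C D] with [A]
    on the first rail and [D] on the second ([three_stick_path]).  This rests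
    on connectedness: consecutive sticks must touch, and the part of the arc
    between two points of a stick is the straight segment joining them.

    If [A, B, C, D] lie in a plane the arc is trivial.  Otherwise they span a
    tetrahedron, and one of the two triangle moves, across [A B C] (replacing
    [A B C D] by [A C D]) or across [B C D] (replacing it by [A B D]), can be
    done without touching the rails; either way two sticks remain, and these
    are coplanar.  To see that one of the moves is free, write the direction of
    the rails in barycentric coordinates as [(a, b, c, e)], with sum [0].  The
    triangle [A B C] is obstructed by a rail exactly when [e = 0] and [b], [c]
    do not have opposite signs, or when [e] is nonzero and none of [a], [b],
    [c] has its sign; for [B C D] exchange [a] and [e].  If both triangles are
    obstructed, then a rail meets the stick [B C] or the two rails coincide
    ([good_triangle]).

    The move across [A B C] is realised by the shears
    [x |-> x + max 0 (min t (tent x)) v], where [v] points from [B] to the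
    midpoint of [A C].  Cutting the push at height [t], instead of multiplying
    it by [t], keeps the isotopy piecewise linear in space and time together.
    The function [tent] is a minimum of eight affine functions, is positive
    only close to the triangle, and equals the [B]-coordinate on the sticks
    [A B] and [B C] ([tent_on_edges]), so that at time [1] the arc lies in the
    plane where that coordinate vanishes ([push_flattens]).

    A shear whose height is built from affine functions by [min] and [max] has
    an inverse of the same form, with [min] and [max] exchanged
    ([inverse_heights_max], [inverse_heights_affine]); this gives piecewise
    linear inverses directly.

    Finally the stick number is a genuine minimum, since a piecewise linear arc
    is a finite union of sticks ([arc_union_of_sticks]). *)

(** * Piecewise linear maps *)

Section PLMaps.
Context (R : realType).
Implicit Types (U V W : normedModType R).

Lemma linear_of V W (f : V -> W) : linear f -> exists L : {linear V -> W}, L =1 f.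
Proof.
move=> lf.
pose m := GRing.isLinear.Build _ _ _ _ f lf.
pose L : {linear V -> W} := HB.pack f m.
by exists L.
Qed.

Lemma affine_on_of V W (P : set V) (f : V -> W) (l : V -> W) (c : W) :
  linear l -> (forall x, P x -> f x = l x + c) -> affine_on P f.
Proof.
by move=> /linear_of[L LE] fE; exists L, c => x Px; rewrite LE fE.
Qed.

Lemma affine_onS V W (P Q : set V) (f : V -> W) :
  P `<=` Q -> affine_on Q f -> affine_on P f.
Proof. by move=> PQ [L [c fE]]; exists L, c => x /PQ/fE. Qed.

Lemma convex_polyhedronT V : convex_polyhedron [set: V].
Proof.
exists 0%N, (fun=> \0 : {linear V -> R^o}), (fun=> 0).
by apply/seteqP; split=> // x _ [].
Qed.

Lemma convex_polyhedronI V (P Q : set V) :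
  convex_polyhedron P -> convex_polyhedron Q -> convex_polyhedron (P `&` Q).
Proof.
move=> [k [phi [b ->]]] [k' [phi' [b' ->]]].
exists (k + k')%N, (fun i : 'I_(k + k') =>
    match fintype.split i with inl j => phi j | inr j => phi' j end),
  (fun i : 'I_(k + k') =>
    match fintype.split i with inl j => b j | inr j => b' j end).
apply/seteqP; split=> x /= => [[h h'] i|h]; first by case: (fintype.split i).
split=> i.
- have := h (lshift k' i); case: split_ordP => j /eqP;
    by rewrite ?eq_lshift ?eq_lrshift // => /eqP ->.
- have := h (rshift k i); case: split_ordP => j /eqP;
    by rewrite ?eq_rshift ?eq_rlshift // => /eqP ->.
Qed.

(** Pulling a polyhedron back along an affine branch of a piecewise linear map
    is what makes compositions piecewise linear. *)
Lemma convex_polyhedron_preim V W (L : {linear V -> W}) c (Q : set W) :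
  convex_polyhedron Q -> convex_polyhedron [set x | Q (L x + c)].
Proof.
move=> [k [phi [b ->]]].
exists k, (fun i => phi i \o L : {linear V -> R^o}), (fun i => b i - phi i c).
by apply/seteqP; split=> x /= h i; have := h i; rewrite linearD lerBrDr.
Qed.

Lemma convex_polyhedron_halfspace V (L : {linear V -> R^o}) (c : R^o) :
  convex_polyhedron [set x | L x <= c].
Proof.
exists 1%N, (fun=> L), (fun=> c).
by apply/seteqP; split=> x /= h; [move=> _ | exact: (h ord0)].
Qed.

Lemma lerBB_DD (a b c d : R) : (a - b <= d - c) = (a + c <= b + d).
Proof. by rewrite lerBlDr addrAC lerBrDr [d + b]addrC. Qed.

Definition finitely_pl V W (f : V -> W) : Prop :=
  exists (I : finType) (P : I -> set V),
    [/\ forall i, convex_polyhedron (P i),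
        forall i, affine_on (P i) f
      & forall x, exists i, P i x].

Lemma finitely_pl_affine V W (f l : V -> W) c :
  linear l -> (forall x, f x = l x + c) -> finitely_pl f.
Proof.
move=> ll fE; exists unit, (fun=> setT); split=> [_|_|x]; last by exists tt.
- exact: convex_polyhedronT.
- exact: (affine_on_of ll).
Qed.

(** Each piece of the common refinement is cut along the hyperplane where the
    affine expressions of [f] and [g] agree; [h] is affine on either side. *)
Lemma finitely_pl_select V (f g h : V -> R^o) :
  finitely_pl f -> finitely_pl g ->
  (forall x, f x <= g x -> h x = f x) -> (forall x, g x <= f x -> h x = g x) ->
  finitely_pl h.
Proof.
move=> [I [P [cP aP covP]]] [J [Q [cQ aQ covQ]]] hf hg.
have /choice[lf fE] i := aP i; have /choice[cf {}fE] := fE.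
have /choice[lg gE] j := aQ j; have /choice[cg {}gE] := gE.
pose S (k : (I * J) * bool) := P k.1.1 `&` Q k.1.2 `&`
  if k.2 then [set x | (lf k.1.1 \- lg k.1.2) x <= cg k.1.2 - cf k.1.1]
  else [set x | (lg k.1.2 \- lf k.1.1) x <= cf k.1.1 - cg k.1.2].
exists ((I * J) * bool)%type, S; split.
- case=> [[i j]] b; apply: convex_polyhedronI.
    by apply: convex_polyhedronI.
  by case: b; exact: convex_polyhedron_halfspace.
- case=> [[i j]] [].
  + exists (lf i), (cf i) => x [[Px Qx]] /= le_fg.
    by rewrite -(fE i x Px) hf// (fE i x Px) (gE j x Qx) -lerBB_DD.
  + exists (lg j), (cg j) => x [[Px Qx]] /= le_gf.
    by rewrite -(gE j x Qx) hg// (fE i x Px) (gE j x Qx) -lerBB_DD.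
- move=> x; have [i Pi] := covP x; have [j Qj] := covQ x.
  have := fE i x Pi; have := gE j x Qj => gx fx.
  have [le_fg|/ltW le_gf] := leP (f x) (g x).
  + by exists (i, j, true); split=> //=; rewrite lerBB_DD -fx -gx.
  + by exists (i, j, false); split=> //=; rewrite lerBB_DD -fx -gx.
Qed.

Lemma pl_on_finType V W (D : set V) (f : V -> W) :
  (forall x, D x -> exists (I : finType) (P : I -> set V),
    [/\ forall i, convex_polyhedron (P i),
        forall i, affine_on (D `&` P i) f
      & \forall y \near x, D y -> exists i, P i y]) -> pl_on D f.
Proof.
move=> h x /h[I [P [cP aP nP]]].
exists #|I|, (P \o enum_val); split=> [i|i|]; [exact: cP|exact: aP|].
by apply: filterS nP => y yP /yP[i Pi]; exists (enum_rank i); rewrite /= enum_rankK.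
Qed.

Lemma finitely_pl_on V W (D : set V) (f : V -> W) : finitely_pl f -> pl_on D f.
Proof.
move=> [I [P [cP aP covP]]]; apply: pl_on_finType => x _.
exists I, P; split=> // [i|]; first by apply: affine_onS (aP i) => y [].
by near=> y.
Unshelve. all: by end_near. Qed.

(** The pieces of [f] near [x] are asked to cover the values of [g] rather than
    a neighbourhood of [g x]: a cover of the whole space by pieces of [f] gives
    this for any [g], and continuity of [g] gives it for any [f]. *)
Lemma pl_on_comp U V W (D : set U) (E : set V) (g : U -> V) (f : V -> W) :
  pl_on D g -> (forall x, D x -> E (g x)) ->
  (forall x, D x -> exists (J : finType) (Q : J -> set V),
    [/\ forall j, convex_polyhedron (Q j),
        forall j, affine_on (E `&` Q j) f
      & \forall y \near x, D y -> exists j, Q j (g y)]) ->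
  pl_on D (f \o g).
Proof.
move=> plg gDE hf; apply: pl_on_finType => x Dx.
have [n [P [cP aP nP]]] := plg x Dx; have [J [Q [cQ aQ nQ]]] := hf x Dx.
have /choice[L gE] i := aP i; have /choice[c {}gE] := gE.
exists ('I_n * J)%type, (fun k => P k.1 `&` [set y | Q k.2 (L k.1 y + c k.1)]).
split=> [[i j]|[i j]|] /=.
- by apply: convex_polyhedronI (cP i) (convex_polyhedron_preim _ _ (cQ j)).
- have [M [e fE]] := aQ j.
  exists (M \o L i : {linear U -> W}), (M (c i) + e) => y [Dy [Py Qy]] /=.
  have gy := gE i y (conj Dy Py).
  by rewrite fE ?gy ?linearD ?addrA//; split=> //; rewrite -gy; apply: gDE.
- apply: filterS2 nP nQ => y nPy nQy Dy.
  have [i Pi] := nPy Dy; have [j Qj] := nQy Dy.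
  by exists (i, j); split=> //=; rewrite -gE.
Qed.

Lemma pl_on_comp_finitely U V W (D : set U) (g : U -> V) (f : V -> W) :
  pl_on D g -> finitely_pl f -> pl_on D (f \o g).
Proof.
move=> plg [J [Q [cQ aQ covQ]]].
apply: (@pl_on_comp _ _ _ _ setT) => // x _; exists J, Q; split=> //.
  by move=> j; apply: affine_onS (aQ j) => y [].
by near=> y => _; exact: covQ.
Unshelve. all: by end_near. Qed.

Lemma pl_on_comp_continuous U V W (D : set U) (E : set V) (g : U -> V) (f : V -> W) :
  pl_on D g -> continuous g -> (forall x, D x -> E (g x)) -> pl_on E f ->
  pl_on D (f \o g).
Proof.
move=> plg cg gDE plf; apply: (pl_on_comp plg gDE) => x Dx.
have [n [Q [cQ aQ nQ]]] := plf _ (gDE x Dx); exists 'I_n, Q; split=> //.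
have := cg x _ nQ; rewrite nbhs_simpl /= => nQg.
by apply: filterS nQg => y /= Qy /gDE.
Qed.

Lemma pl_on_pair U V W (D : set U) (g : U -> V) (h : U -> W) l c :
  pl_on D g -> linear l -> (forall x, h x = l x + c) ->
  pl_on D (fun x => (g x, h x)).
Proof.
move=> plg ll hE; apply: pl_on_finType => x /plg[n [P [cP aP nP]]].
exists 'I_n, P; split=> // i; have [L [b gE]] := aP i.
apply: (@affine_on_of _ _ _ _ (fun x => (L x, l x)) (b, c)).
  by move=> a y z; rewrite linearP ll.
by move=> y Py; rewrite gE// hE.
Qed.

End PLMaps.

(** * Shears and the rail isotopies they define *)

Section Shears.
Context (R : realType).
Local Notation E3 := 'rV[R]_3.
Implicit Types (v x : E3) (t s : R) (m n : E3 * R^o -> R^o).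

(** The height [m] is a function of space and time, so that a single piecewise
    linear [m] describes a whole isotopy of shears along [v]. *)
Definition shear v m t x : E3 := x + m (x, t) *: v.

(** The last condition says that at each time the shear by [m] preserves the
    order of every line parallel to [v]. *)
Definition monotone_height v m : Prop :=
  [/\ finitely_pl m, continuous m
    & forall x t s, 0 <= s -> m (x, t) <= s + m (x + s *: v, t)].

(** The last two conditions say that the shears by [m] and by [n] are inverse
    to each other at each time. *)
Definition inverse_heights v m n : Prop :=
  [/\ monotone_height v m, monotone_height v n,
      forall x t, n (x + m (x, t) *: v, t) = - m (x, t)
    & forall x t, m (x + n (x, t) *: v, t) = - n (x, t)].

Lemma inverse_heights_sym v m n : inverse_heights v m n -> inverse_heights v n m.
Proof. by case. Qed.

Lemma finitely_pl_opp m : finitely_pl m -> finitely_pl (\- m).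
Proof.
move=> [I [P [cP aP covP]]]; exists I, P; split=> // i.
have [L [c mE]] := aP i.
apply: (@affine_on_of _ _ _ _ _ (fun p => - L p) (- c)) => [a p q|p Pp /=].
  by rewrite linearP opprD scalerN.
by rewrite mE // opprD.
Qed.

Lemma finitely_pl_min m n : finitely_pl m -> finitely_pl n -> finitely_pl (m \min n).
Proof.
move=> pm pn; apply: (finitely_pl_select pm pn) => p le_mn /=.
- exact: min_l.
- exact: min_r.
Qed.

Lemma finitely_pl_max m n : finitely_pl m -> finitely_pl n -> finitely_pl (m \max n).
Proof.
move=> pm pn.
have -> : m \max n = \- ((\- m) \min (\- n)).
  by apply/funext => p /=; rewrite oppr_min !opprK.
by apply/finitely_pl_opp/finitely_pl_min; apply: finitely_pl_opp.
Qed.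

Lemma monotone_height_max v m n : monotone_height v m ->
  monotone_height v n -> monotone_height v (m \max n).
Proof.
move=> [pm cm im] [pn cn jn]; split; first exact: finitely_pl_max.
  by move=> p; apply: continuous_max; [exact: cm|exact: cn].
move=> x t s s0 /=; have := im x t s s0; have := jn x t s s0.
by rewrite addr_maxr ge_max !le_max => -> ->; rewrite orbT.
Qed.

Lemma monotone_height_min v m n : monotone_height v m ->
  monotone_height v n -> monotone_height v (m \min n).
Proof.
move=> [pm cm im] [pn cn jn]; split; first exact: finitely_pl_min.
  by move=> p; apply: continuous_min; [exact: cm|exact: cn].
move=> x t s s0 /=; have := im x t s s0; have := jn x t s s0.
by rewrite addr_minr le_min !ge_min => -> ->; rewrite orbT.
Qed.

(** The shears preserve the order of each line parallel to [v]; the inverse of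
    the upper of two increasing maps is the lower of their inverses. *)
Lemma inverse_heights_max v m n m' n' :
  inverse_heights v m n -> inverse_heights v m' n' ->
  inverse_heights v (m \max m') (n \min n').
Proof.
move=> [hm hn mnK nmK] [hm' hn' mnK' nmK'].
have [_ _ im] := hm; have [_ _ jn] := hn.
have [_ _ im'] := hm'; have [_ _ jn'] := hn'.
have shift x (a b : R) : x + b *: v = (x + a *: v) + (b - a) *: v.
  by rewrite -addrA -scalerDl [a + _]addrC subrK.
split; [exact: monotone_height_max|exact: monotone_height_min| |].
- move=> x t /=; have [le_mm'|/ltW le_mm'] := leP (m (x, t)) (m' (x, t)).
  + rewrite mnK'; apply: min_r; rewrite (shift _ (m (x, t))).
    have d0 : 0 <= (m' (x, t) : R) - m (x, t) by rewrite subr_ge0.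
    have := jn (x + m (x, t) *: v) t _ d0; rewrite mnK.
    set k := n _; lra.
  + rewrite mnK; apply: min_l; rewrite (shift _ (m' (x, t))).
    have d0 : 0 <= (m (x, t) : R) - m' (x, t) by rewrite subr_ge0.
    have := jn' (x + m' (x, t) *: v) t _ d0; rewrite mnK'.
    set k := n' _; lra.
- move=> x t /=; have [le_nn'|/ltW le_nn'] := leP (n (x, t)) (n' (x, t)).
  + rewrite nmK; apply: max_l.
    have d0 : 0 <= (n' (x, t) : R) - n (x, t) by rewrite subr_ge0.
    have := im' (x + n (x, t) *: v) t _ d0; rewrite -shift nmK'.
    set k := m' _; lra.
  + rewrite nmK'; apply: max_r.
    have d0 : 0 <= (n (x, t) : R) - n' (x, t) by rewrite subr_ge0.
    have := im (x + n' (x, t) *: v) t _ d0; rewrite -shift nmK.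
    set k := m _; lra.
Qed.

Lemma inverse_heights_min v m n m' n' :
  inverse_heights v m n -> inverse_heights v m' n' ->
  inverse_heights v (m \min m') (n \max n').
Proof.
move=> h h'; apply/inverse_heights_sym/inverse_heights_max;
  exact: inverse_heights_sym.
Qed.

(** Moving a point along [v] by the height [h = l + c] multiplies its height by
    [1 + q]; the way back is thus the new height divided by [- (1 + q)], and
    order is preserved because [1 + q > 0]. *)
Lemma inverse_heights_affine v (l : E3 * R^o -> R^o) (c q : R) :
  linear l -> continuous l -> l (v, 0) = q -> -1 < q ->
  inverse_heights v (fun p => l p + c) (fun p => - (l p + c) / (1 + q)).
Proof.
move=> ll cl lv q1; have q0 : 0 < 1 + q by lra.
have lin x t s : l (x + s *: v, t) = l (x, t) + s * q.
  have := ll s (v, 0) (x, t); rewrite lv [RHS]addrC => <-; congr l.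
  by apply/pair_equal_spec; split => /=; rewrite ?scaler0 ?add0r // addrC.
split.
- split; first exact: (finitely_pl_affine ll).
    by move=> p; apply: cvgD; [exact: cl|exact: cvg_cst].
  by move=> x t s s0; rewrite lin; nra.
- split.
  + apply: (@finitely_pl_affine _ _ _ _ (fun p => - l p / (1 + q)) (- c / (1 + q))).
      move=> a p p'; rewrite ll /= /GRing.scale /=; field; lra.
    by move=> p; field; lra.
  + move=> p; apply: cvgMl; apply: cvgN; apply: cvgD; [exact: cl|exact: cvg_cst].
  + move=> x t s s0; rewrite lin -subr_ge0.
    suff -> : s + - (l (x, t) + s * q + c) / (1 + q) - - (l (x, t) + c) / (1 + q)
      = s / (1 + q) by rewrite divr_ge0 // ltW.
    by field; lra.
- by move=> x t; rewrite lin; field; lra.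
- by move=> x t; rewrite lin; field; lra.
Qed.

Lemma finitely_pl_shear v m : finitely_pl m ->
  finitely_pl (fun p : E3 * R^o => shear v m p.2 p.1).
Proof.
move=> [I [P [cP aP covP]]]; exists I, P; split=> // i.
have [L [c mE]] := aP i.
apply: (@affine_on_of _ _ _ _ _ (fun p => p.1 + L p *: v) (c *: v)) => [a p q|p Pp].
  by rewrite linearP /= !scalerDr scalerDl !scalerA addrACA.
by case: p Pp => x t Pp; rewrite /shear mE //= scalerDl addrA.
Qed.

Lemma shear_continuous v m : continuous m ->
  continuous (fun p : E3 * R^o => shear v m p.2 p.1).
Proof.
move=> cm.
have -> : (fun p : E3 * R^o => shear v m p.2 p.1) = (fun p => p.1 + m p *: v).
  by apply/funext => -[].
move=> p; apply: cvgD; first exact: cvg_fst.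
by apply: cvgZr_tmp; exact: cm.
Qed.

Lemma continuous_shear_track v m : continuous m ->
  continuous (fun p : E3 * R^o => (shear v m p.2 p.1, p.2)).
Proof. by move=> cm p; apply: (cvg_pair (@shear_continuous v m cm p) cvg_snd). Qed.

Lemma shearK v m n : inverse_heights v m n -> forall t, cancel (shear v m t) (shear v n t).
Proof. by move=> [_ _ mnK _] t x; rewrite /shear mnK scaleNr addrK. Qed.

Lemma rail_isotopic_refl (l1 l2 r : set E3) : rail_isotopic l1 l2 r r.
Proof.
exists (fun=> id); split=> [|t _|]; rewrite ?image_id //.
have plid : pl_on [set p : E3 * R^o | unit_interval p.2] (fun p => p.1).
  apply/finitely_pl_on/(@finitely_pl_affine _ _ _ _ fst 0) => // p.
  by rewrite addr0.
by split=> //; exists (fun=> id).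
Qed.

Lemma shear_fixed_rail v m (l : set E3) t :
  (forall x t, l x -> m (x, t) = 0) -> shear v m t @` l = l.
Proof.
move=> ml; apply/seteqP; split=> [_ [x lx <-]|x lx].
  by rewrite /shear ml // scale0r addr0.
by exists x => //; rewrite /shear ml // scale0r addr0.
Qed.

(** The two isotopies are composed level by level instead of being run one after
    the other, which keeps the time parameter as it is.  The inverse of the
    composite applies the inverse shear first, which is where its continuity is
    used: [G] is piecewise linear only locally. *)
Lemma rail_isotopic_shear v m n (l1 l2 r r' : set E3) :
  inverse_heights v m n -> (forall x, m (x, 0) = 0) ->
  (forall x t, l1 x -> m (x, t) = 0) -> (forall x t, l2 x -> m (x, t) = 0) ->
  rail_isotopic l1 l2 r r' -> rail_isotopic l1 l2 r (shear v m 1 @` r').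
Proof.
move=> mn m0 ml1 ml2 [H [[plH H0 [G plG HG]] Hl Hr]].
have [[pm _ _] [pn cn _] _ _] := mn.
exists (fun t => shear v m t \o H t); split.
- split.
  + have plH2 : pl_on [set p : E3 * R^o | unit_interval p.2]
      (fun p => (H p.2 p.1, p.2)).
      by apply: (@pl_on_pair _ _ _ _ _ _ _ snd 0) => // p; rewrite addr0.
    exact: pl_on_comp_finitely plH2 (finitely_pl_shear v pm).
  + by move=> x; rewrite /= H0 /shear m0 scale0r addr0.
  + exists (fun t => G t \o shear v n t).
      have pln : pl_on [set p : E3 * R^o | unit_interval p.2]
        (fun p => (shear v n p.2 p.1, p.2)).
        apply: (@pl_on_pair _ _ _ _ _ _ _ snd 0) => // [|p]; last by rewrite addr0.
        exact/finitely_pl_on/finitely_pl_shear.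
      by apply: (pl_on_comp_continuous pln _ _ plG); 
        first exact: continuous_shear_track.
    move=> t /HG[HK GK]; split.
      by apply: can_comp HK; exact: shearK mn t.
    by apply: can_comp GK _; exact: shearK (inverse_heights_sym mn) t.
- move=> t ti; have [Hl1 Hl2] := Hl t ti.
  by split; rewrite -image_comp ?Hl1 ?Hl2 shear_fixed_rail.
- by rewrite -image_comp Hr.
Qed.

Lemma rail_arc_shear v m n (l1 l2 r : set E3) :
  inverse_heights v m n ->
  (forall x t, l1 x -> m (x, t) = 0) -> (forall x t, l2 x -> m (x, t) = 0) ->
  rail_arc l1 l2 r -> rail_arc l1 l2 (shear v m 1 @` r).
Proof.
move=> mn ml1 ml2 [g [plg injg -> [g0 g1] gint]].
have [[pm _ _] _ _ _] := mn.
have injs : injective (shear v m 1) := can_inj (shearK mn 1).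
have fixl (l : set E3) x : (forall x t, l x -> m (x, t) = 0) ->
    l (shear v m 1 x) <-> l x.
  move=> ml; split=> lx; last by rewrite /shear ml // scale0r addr0.
  have := shear_fixed_rail v 1 ml => {}ml; move: lx; rewrite -{1}ml => -[y ly /injs <- //].
exists (shear v m 1 \o g); split.
- have plg1 : pl_on (@unit_interval R) (fun t => (g t, 1 : R^o)).
    apply: (pl_on_pair (h := fun=> 1 : R^o) (l := fun=> 0) (c := 1) plg) => [a x y|x].
      by rewrite scaler0 add0r.
    by rewrite add0r.
  exact: (pl_on_comp_finitely plg1 (finitely_pl_shear v pm)).
- by move=> s t si ti /= /injs; exact: injg.
- by rewrite image_comp.
- by split=> /=; apply/fixl.
- by move=> t /gint[n1 n2]; split=> /=; rewrite fixl.
Qed.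

End Shears.

(** * Barycentric coordinates of a tetrahedron *)

Section Functionals.
Context (R : realType).
Local Notation E3 := 'rV[R]_3.

Lemma linear_rVE (l : E3 -> R^o) : linear l ->
  forall x, l x = (x *m (\col_k l (delta_mx 0 k))) 0 0.
Proof.
move=> /linear_of[L lE] x; rewrite -lE [in LHS](row_sum_delta x) linear_sum /= mxE.
by apply: eq_bigr => k _; rewrite linearZ /= !mxE lE.
Qed.

Lemma linear_rV_continuous (l : E3 -> R^o) : linear l -> continuous l.
Proof.
move=> ll; have -> : l = fun x => \sum_(k < 3) (x 0 k * l (delta_mx 0 k)).
  by apply/funext => y; rewrite linear_rVE // mxE; apply: eq_bigr => k _; rewrite mxE.
move=> x; apply: continuous_big => [|k _ {}x]; first exact: add_continuous.
by apply: continuousM; [exact: coord_continuous|exact: cst_continuous].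
Qed.

Definition barycentric (p : 'I_4 -> E3) (l : 'I_4 -> {linear E3 -> R^o})
    (c : 'I_4 -> R) : Prop :=
  [/\ forall i j, l i (p j) + c i = (i == j)%:R,
      forall x, \sum_i (l i x + c i) *: p i = x
    & forall x, \sum_i (l i x + c i) = 1].

(** The matrix with rows [(p i, 1)] is invertible: a vector in its kernel is the
    equation of a plane through the four points.  Its inverse gives the
    coordinates. *)
Lemma barycentric_exists (p : 'I_4 -> E3) :
  (forall P, plane P -> ~ forall i, P (p i)) ->
  exists l c, barycentric p l c.
Proof.
move=> indep.
pose M : 'M[R]_(3 + 1) := \matrix_i row_mx (p i) 1%:M.
have rowM i : row i M = row_mx (p i) 1%:M by rewrite rowK.
have Mu : M \in unitmx.
  rewrite unitmxE unitfE -det_tr; apply/negP => /det0P[w w0 wM].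
  pose z : 'cV[R]_(3 + 1) := w^T.
  have pz i : p i *m usubmx z + dsubmx z = 0.
    have : row i (M *m z) = 0 by rewrite -[M]trmxK -trmx_mul wM trmx0 row0.
    by rewrite row_mul rowM -[in X in _ *m X](vsubmxK z) mul_row_col mul1mx.
  have [u0|u0] := eqVneq (usubmx z) 0.
    have := pz ord0; rewrite u0 mulmx0 add0r => d0.
    by move: w0; rewrite -(trmxK w) -/z -(vsubmxK z) u0 d0 col_mx0 trmx0 eqxx.
  apply: (indep [set x | (x *m usubmx z) 0 0 = - dsubmx z 0 0]).
    by exists (usubmx z), (- dsubmx z 0 0).
  by move=> i /=; have /matrixP/(_ 0 0) := pz i; rewrite !mxE => /eqP;
    rewrite addr_eq0 => /eqP.
pose W := invmx M.
have lin i : linear (fun x : E3 => (row_mx x 0 *m W) 0 i : R^o).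
  by move=> a x y; rewrite -[in LHS](addr0 0) -[X in row_mx _ (X + _)](scaler0 _ a)
    -add_row_mx -scale_row_mx mulmxDl -scalemxAl !mxE.
have /choice[l lE] i := linear_of (lin i).
pose c i := (row_mx (0 : E3) 1%:M *m W) 0 i.
have lcE x i : l i x + c i = (row_mx x 1%:M *m W) 0 i.
  have -> : row_mx x 1%:M = row_mx x 0 + row_mx 0 1%:M :> 'rV[R]_(3 + 1).
    by rewrite add_row_mx addr0 add0r.
  by rewrite lE mulmxDl [RHS]mxE.
have lcM x : \sum_i (l i x + c i) *: row i M = row_mx x 1%:M.
  rewrite -[RHS]mulmx1 -(mulVmx Mu) mulmxA [RHS]mulmx_sum_row.
  by apply: eq_bigr => i _; rewrite lcE.
exists l, c; split.
- move=> i j; rewrite lcE -rowM -row_mul mulmxV // rowE mulmx1 mxE eqxx.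
  by rewrite eq_sym.
- move=> x; rewrite -[RHS](row_mxKl x (1%:M : 'M[R]_1)) -lcM linear_sum.
  by apply: eq_bigr => i _; rewrite linearZ /= rowM row_mxKl.
- move=> x; have -> : 1 = rsubmx (row_mx x (1%:M : 'M[R]_1)) 0 0.
    by rewrite row_mxKr mxE eqxx.
  rewrite -lcM linear_sum summxE; apply: eq_bigr => i _.
  by rewrite linearZ /= rowM row_mxKr !mxE eqxx mulr1.
Qed.

End Functionals.

(** * Which triangle is free of the rails *)

Section Numbers.
Context (R : realType).
Implicit Types a b c e s N : R.

(** For a tetrahedron [A B C D], the parallels through [A] and [D] to the vector
    with barycentric coordinates [(a, b, c, e)] should meet the triangle
    [A B C] at most in [A].  This fails in two ways.  If [e = 0], the parallel
    through [A] lies in the plane of the triangle and enters the angle at [A]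
    unless [b] and [c] have opposite signs.  If [e <> 0], the parallel through [D]
    crosses that plane at the point [(- a / e, - b / e, - c / e)], which is in
    the triangle when no coordinate is negative. *)
Definition bad_direction a b c e : Prop :=
  [\/ e = 0 /\ 0 <= b * c | [/\ e != 0, a * e <= 0, b * e <= 0 & c * e <= 0]].

(** One constant bounds all the ratios between coordinates of the direction; it
    fixes the slopes of the tent. *)
Lemma comparable_ratios (I : finType) (q : I -> R) :
  exists2 N : R, 1 <= N & forall i j, q j != 0 -> `|q i| <= N * `|q j|.
Proof.
exists (1 + (\sum_i `|q i|) * (\sum_j `|q j|^-1)) => [|i j qj0].
  by rewrite lerDl mulr_ge0 ?sumr_ge0 // => k _; rewrite invr_ge0.
have le1 (f : I -> R) k : (forall k, 0 <= f k) -> f k <= \sum_k f k.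
  by move=> f0; rewrite (bigD1 k) //= lerDl sumr_ge0.
have qj : 0 < `|q j| by rewrite normr_gt0.
rewrite -ler_pdivrMr // (@le_trans _ _ ((\sum_i `|q i|) * (\sum_j `|q j|^-1))) //.
  by apply: ler_pM; rewrite ?invr_ge0 // le1 // => k; rewrite invr_ge0.
by rewrite lerDr.
Qed.

(** At a point with barycentric coordinates [(a, b, c, e)], one of the affine
    functions [b + k w - 2 N |e|], with slope [k] flat ([1 / N]) or steep
    ([2 N]) and [w] one of [a] and [c], is nonpositive.  The tent, being the
    minimum of these functions, is then nonpositive too. *)
Definition below_piece N b a c e : Prop :=
  exists k w : bool,
    b + (if k then 2 * N else N^-1) * (if w then c else a) <= 2 * N * `|e|.

Lemma below_at_vertex_tilted N s b c e : 1 <= N -> e != 0 ->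
  `|b| <= N * `|e| -> `|c| <= N * `|e| ->
  s * b + N^-1 * (s * c) <= 2 * N * `|s * e|.
Proof.
move=> N1 e0 be ce; have N0 : 0 < N by lra.
have V1 : N^-1 <= 1 by rewrite invf_le1.
have V0 : 0 < N^-1 by rewrite invr_gt0.
have se : 0 <= N * `|s * e| by rewrite mulr_ge0 // ltW.
have sb : s * b <= N * `|s * e|.
  by apply: (le_trans (ler_norm _)); rewrite !normrM mulrCA ler_wpM2l.
have sc : s * c <= N * `|s * e|.
  by apply: (le_trans (ler_norm _)); rewrite !normrM mulrCA ler_wpM2l.
have : N^-1 * (s * c) <= N * `|s * e|.
  apply: (@le_trans _ _ (N^-1 * (N * `|s * e|))); first by rewrite ler_pM2l.
  by rewrite ler_piMl.
nra.
Qed.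

Lemma below_steep N s b w : 1 <= N -> s * w < 0 -> `|b| <= N * `|w| ->
  s * b + 2 * N * (s * w) <= 0.
Proof.
move=> N1 sw bw.
have : s * b <= N * `|s * w|.
  by apply: (le_trans (ler_norm _)); rewrite !normrM mulrCA ler_wpM2l.
by rewrite ltr0_norm //; nra.
Qed.

Lemma below_flat N s b w : 1 <= N -> s * b <= 0 -> `|w| <= N * `|b| ->
  s * b + N^-1 * (s * w) <= 0.
Proof.
move=> N1 sb wb; have N0 : 0 < N by lra.
have : N^-1 * (s * w) <= `|s * b|.
  rewrite ler_pdivrMl //; apply: (le_trans (ler_norm _)).
  by rewrite !normrM mulrCA ler_wpM2l.
by rewrite ler0_norm //; lra.
Qed.

(** The point at parameter [s] is [(1 + s a, s b, s c, s e)] on the rail through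
    [A] and [(s a, s b, s c, 1 + s e)] on the rail through [D].  When [e] is
    nonzero, leaving the plane of the triangle outweighs everything on the
    first rail, and on the part of the second rail where [s e >= 0].  Elsewhere,
    for [s] nonzero, the direction being good makes [s a], [s b] or [s c]
    negative: a negative [s b] outweighs a flat slope, and a steep slope on a
    negative [s a] or [s c] outweighs [s b]. *)
Lemma below_rails N a b c e : 1 <= N ->
  (forall x y, x \in [:: a; b; c; e] -> y \in [:: a; b; c; e] ->
     y != 0 -> `|x| <= N * `|y|) ->
  ~ bad_direction a b c e ->
  forall s, below_piece N (s * b) (1 + s * a) (s * c) (s * e) /\
            below_piece N (s * b) (s * a) (s * c) (1 + s * e).
Proof.
move=> N1 ratio good s.
have [ia ib ic ie] : [/\ a \in [:: a; b; c; e], b \in [:: a; b; c; e],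
    c \in [:: a; b; c; e] & e \in [:: a; b; c; e]].
  by rewrite !inE !eqxx !orbT.
have N0 : 0 < N by lra.
have Ke x : 0 <= 2 * N * `|x| by rewrite mulr_ge0 //; lra.
have [e0|e0] := eqVneq e 0.
  have bc : b * c < 0.
    by rewrite ltNge; apply/negP => bc; apply: good; left.
  have b0 : b != 0 by apply: contraTneq bc => ->; rewrite mul0r ltxx.
  suff [k hk] : exists k : bool,
      s * b + (if k then 2 * N else N^-1) * (s * c) <= 0.
    by split; exists k, true; apply: le_trans hk _; exact: Ke.
  have [sb|sb] := leP (s * b) 0.
    by exists false; apply: below_flat => //; exact: ratio.
  have s0 : s != 0 by apply: contraTneq sb => ->; rewrite mul0r ltxx.
  have sc : s * c < 0.
    have E : (s * b) * (s * c) = (s * s) * (b * c) by ring.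
    by rewrite -(pmulr_rlt0 _ sb) E pmulr_rlt0 // -expr2 exprn_even_gt0.
  have c0 : c != 0 by apply: contraTneq sc => ->; rewrite mulr0 ltxx.
  by exists true; apply: below_steep => //; exact: ratio.
have tilted := below_at_vertex_tilted s N1 e0 (ratio _ _ ib ie e0) (ratio _ _ ic ie e0).
split; first by exists false, true.
have [se|se] := leP 0 (s * e).
  exists false, true => /=; apply: le_trans tilted _.
  by rewrite ler_pM2l ?mulr_gt0 // !ger0_norm ?lerDr ?addr_ge0.
have se2 x : (0 < x * e -> s * x < 0) * (x * e <= 0 -> 0 <= s * x).
  have e2 : 0 < e * e by rewrite -expr2 exprn_even_gt0.
  have xs : (x * e) * (s * e) = (s * x) * (e * e) by ring.
  split=> xe.
    by rewrite -(pmulr_llt0 _ e2) -xs pmulr_rlt0.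
  by rewrite -(pmulr_lge0 _ e2) -xs mulr_le0 // ltW.
suff [k [w hk]] : exists k w : bool, s * b +
    (if k then 2 * N else N^-1) * (if w then s * c else s * a) <= 0.
  by exists k, w; apply: le_trans hk _; exact: Ke.
have [ae|ae] := leP (a * e) 0; last first.
  have sa := (se2 a).1 ae.
  have a0 : a != 0 by apply: contraTneq sa => ->; rewrite mulr0 ltxx.
  by exists true, false; apply: below_steep => //; exact: ratio.
have [ce|ce] := leP (c * e) 0; last first.
  have sc := (se2 c).1 ce.
  have c0 : c != 0 by apply: contraTneq sc => ->; rewrite mulr0 ltxx.
  by exists true, true; apply: below_steep => //; exact: ratio.
have be : 0 < b * e by rewrite ltNge; apply/negP => be; apply: good; right.
have sb := (se2 b).1 be.
have b0 : b != 0 by apply: contraTneq sb => ->; rewrite mulr0 ltxx.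
by exists false, true; apply: below_flat; [|exact: ltW|exact: ratio].
Qed.

(** The third and fourth hypotheses say that the rails miss the stick [B C]:
    the point [(1 + s a, s b, s c, s e)] of the first rail lies on [B C] when
    its first and last coordinates vanish and the others are nonnegative.  If
    [b] and [c] both vanish, the direction is that of [A D].  When both
    triangles are obstructed, the signs leave only these possibilities. *)
Lemma one_good_direction a b c e : a + b + c + e = 0 ->
  ~ (b = 0 /\ c = 0) ->
  (forall s, ~ [/\ 1 + s * a = 0, 0 <= s * b, 0 <= s * c & s * e = 0]) ->
  (forall s, ~ [/\ 1 + s * e = 0, 0 <= s * b, 0 <= s * c & s * a = 0]) ->
  bad_direction a b c e -> bad_direction e c b a -> False.
Proof.
move=> sum0 bc0 l1 l2.
have opp_sign (x y : R) : y != 0 -> x * y <= 0 -> 0 <= - y^-1 * x.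
  move=> y0 xy; rewrite -(@pmulr_lge0 _ (y * y)).
    by rewrite (_ : _ * _ = - (x * y)) ?oppr_ge0 //; field.
  by rewrite -expr2 exprn_even_gt0.
move=> [[e0 bc]|[e0 ae be ce]] [[a0 cb]|[a0 ea ca ba]].
- by apply: bc0; split; nra.
- apply: (l1 (- a^-1)); split; rewrite ?e0 ?mulr0 ?mulNr ?mulVf ?subrr -?mulNr //.
  + exact: opp_sign.
  + exact: opp_sign.
- apply: (l2 (- e^-1)); split; rewrite ?a0 ?mulr0 ?mulNr ?mulVf ?subrr -?mulNr //.
  + exact: opp_sign.
  + exact: opp_sign.
- apply: bc0; move: a0 e0; rewrite !neq_lt => /orP[] a0 /orP[] e0; nra.
Qed.

End Numbers.

(** * The triangle move *)

Section TriangleMove.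
Context (R : realType).
Local Notation E3 := 'rV[R]_3.
Implicit Types (v x : E3) (t s : R) (m n : E3 * R^o -> R^o).

Definition invertible_height v m : Prop := exists n, inverse_heights v m n.

Lemma invertible_height_affine v m (l : E3 * R^o -> R^o) c :
  linear l -> continuous l ->
  (forall p, m p = l p + c) -> -1 < l (v, 0) -> invertible_height v m.
Proof.
move=> ll cl /funext -> lv.
by exists (fun p => - (l p + c) / (1 + l (v, 0))); exact: inverse_heights_affine.
Qed.

Lemma invertible_height_max v m n :
  invertible_height v m -> invertible_height v n -> invertible_height v (m \max n).
Proof. by move=> [m' mm'] [n' nn']; exists (m' \min n'); exact: inverse_heights_max. Qed.

Lemma invertible_height_min v m n :
  invertible_height v m -> invertible_height v n -> invertible_height v (m \min n).
Proof. by move=> [m' mm'] [n' nn']; exists (m' \max n'); exact: inverse_heights_min. Qed.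

Definition min2 (f : bool -> E3 * R^o -> R^o) : E3 * R^o -> R^o := f true \min f false.

Lemma min2_le f b p : min2 f p <= f b p.
Proof. by rewrite /min2 /= ge_min; case: b; rewrite lexx ?orbT. Qed.

Lemma le_min2 f (z : R) p : (forall b, z <= f b p) -> z <= min2 f p.
Proof. by move=> zf; rewrite /min2 /= le_min !zf. Qed.

Lemma invertible_height_min2 v f :
  (forall b, invertible_height v (f b)) -> invertible_height v (min2 f).
Proof. by move=> sf; exact: invertible_height_min. Qed.

Section Tent.
Context (p : 'I_4 -> E3) (l : 'I_4 -> {linear E3 -> R^o}) (c : 'I_4 -> R) (N : R).
Hypotheses (bary : barycentric p l c) (N1 : 1 <= N).

Let vA : 'I_4 := inord 0.
Let vB : 'I_4 := inord 1.
Let vC : 'I_4 := inord 2.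
Let vD : 'I_4 := inord 3.
Local Notation coord i x := (l i x + c i).

(** The minimum over [k] and [w] adds to the [B]-coordinate a function which is
    [0] on the edges [A B] and [B C], rises slowly towards the inside of the
    triangle and falls steeply outside.  The minimum over the sign [u] subtracts
    a multiple of the absolute value of the [D]-coordinate, which measures the
    distance to the plane of the triangle. *)
Definition tent_piece (k w u : bool) (z : E3 * R^o) : R^o :=
  coord vB z.1 + (if k then 2 * N else N^-1) * coord (if w then vC else vA) z.1
  - (-1) ^+ u * (2 * N) * coord vD z.1.

Definition tent := min2 (fun k => min2 (fun w => min2 (fun u => tent_piece k w u))).

(** At time [t] the tent is cut at height [t], and what lies below zero is
    removed, so the push vanishes at time [0]. *)
Definition push := (fun=> 0) \max (snd \min tent) : E3 * R^o -> R^o.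

(** From [B] to the midpoint of [A C]: the [B]-coordinate decreases by [1] per
    unit, while those of [A] and [C] increase, so every tent piece has slope
    greater than [- 1] and the shear is invertible. *)
Definition push_direction : E3 := 2^-1 *: (p vA + p vC) - p vB.

Lemma vertex_eq j1 j2 : (j1 < 4)%N -> (j2 < 4)%N ->
  (inord j1 == inord j2 :> 'I_4) = (j1 == j2).
Proof. by move=> h1 h2; rewrite -val_eqE /= !inordK. Qed.

Lemma coord_vertex i j : coord i (p j) = (i == j)%:R.
Proof. by case: bary. Qed.

Lemma functional_sub i j k : l i (p j - p k) = (i == j)%:R - (i == k)%:R.
Proof. by rewrite -!coord_vertex linearB /=; ring. Qed.

Lemma functional_push i : l i push_direction =
  2^-1 * ((i == vA)%:R + (i == vC)%:R) - (i == vB)%:R.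
Proof. by rewrite -!coord_vertex linearB linearZ linearD /=/GRing.scale/=; field. Qed.

Lemma invertible_height_push : invertible_height push_direction push.
Proof.
have N0 : 0 < N := lt_le_trans ltr01 N1.
apply: invertible_height_max.
  apply: (@invertible_height_affine _ _ (fun=> 0) 0).
  - by move=> a x y; rewrite scaler0 addr0.
  - by move=> z; exact: cvg_cst.
  - by move=> z; rewrite addr0.
  - exact: ltrN10.
apply: invertible_height_min.
  apply: (@invertible_height_affine _ _ snd 0).
  - by [].
  - by move=> z; exact: cvg_snd.
  - by move=> z; rewrite addr0.
  - exact: ltrN10.
do 3![apply: invertible_height_min2 => ?].
rewrite /tent_piece; set k := if _ then _ else N^-1; set i := if _ then vC else vA.
set K := _ * (2 * N).
pose L x : R^o := l vB x + k * l i x - K * l vD x.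
have lL : linear L.
  by move=> a x y; rewrite /L !linearP /= /GRing.scale /=; ring.
apply: (@invertible_height_affine _ _ (L \o fst) (c vB + k * c i - K * c vD)).
- by move=> a x y /=; rewrite lL.
- move=> z; apply: continuous_comp; first exact: cvg_fst.
  exact: linear_rV_continuous.
- by move=> z /=; rewrite /L; ring.
have k0 : 0 < k by rewrite /k; case: ifP => _; rewrite ?invr_gt0 ?mulr_gt0.
rewrite /= /L !functional_push /i /vA /vB /vC /vD.
by case: ifP => _; rewrite !vertex_eq //=; lra.
Qed.

Lemma push_at_time0 x : push (x, 0) = 0.
Proof. by rewrite /push /=; apply/max_l; rewrite ge_min lexx. Qed.

Lemma push_outside x t :
  below_piece N (coord vB x) (coord vA x) (coord vC x) (coord vD x) -> push (x, t) = 0.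
Proof.
move=> [k [w kw]]; apply/max_l; rewrite ge_min; apply/orP; right.
(* The sign for which the last term of the piece is the absolute value. *)
pose u := coord vD x < 0.
apply: (le_trans (min2_le _ k _)); apply: (le_trans (min2_le _ w _)).
apply: (le_trans (min2_le _ u _)); rewrite /tent_piece /= subr_le0.
have wE : (if w then coord vC x else coord vA x) = coord (if w then vC else vA) x.
  by case: w kw.
suff -> : (-1) ^+ u * (2 * N) * coord vD x = 2 * N * `|coord vD x| by rewrite -wE.
by rewrite [in RHS]normrEsign /u; ring.
Qed.

(** On the edges [A B] and [B C] one of the coordinates of [A] and [C] vanishes
    and the other is nonnegative, so the added minimum is [0]. *)
Lemma tent_on_edges x t : 0 <= coord vA x -> 0 <= coord vC x ->
  coord vA x = 0 \/ coord vC x = 0 -> coord vD x = 0 ->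
  tent (x, t) = coord vB x.
Proof.
have N0 : 0 < N := lt_le_trans ltr01 N1.
move=> a0 c0 ac d0; apply/eqP; rewrite eq_le; apply/andP; split.
- have [w w0] : exists w : bool, coord (if w then vC else vA) x = 0.
    by case: ac; [exists false|exists true].
  apply: (le_trans (min2_le _ true _)); apply: (le_trans (min2_le _ w _)).
  apply: (le_trans (min2_le _ true _)); rewrite /tent_piece /= w0 d0.
  by rewrite !mulr0 subr0 addr0.
- do 3![apply: le_min2 => ?].
  rewrite /tent_piece /= d0 mulr0 subr0 lerDl; apply: mulr_ge0.
    by case: ifP => _; rewrite ?invr_ge0 ?mulr_ge0 // ltW.
  by case: ifP.
Qed.

Lemma coord_segment i j k s :
  coord i ((1 - s) *: p j + s *: p k) = (1 - s) * (i == j)%:R + s * (i == k)%:R.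
Proof. by rewrite -!coord_vertex linearD !linearZ /= /GRing.scale /=; ring. Qed.

(** The push lowers the [B]-coordinate by exactly its own value: on [A B] and
    [B C] the tent equals that coordinate, and [C D] is left fixed. *)
Lemma push_flattens x :
  (segment (p vA) (p vB) `|` segment (p vB) (p vC) `|` segment (p vC) (p vD)) x ->
  coord vB (shear push_direction push 1 x) = 0.
Proof.
move=> xr; suff pE : push (x, 1) = coord vB x.
  rewrite /shear linearD linearZ /= functional_push pE /vA /vB /vC !vertex_eq //=.
  by rewrite /GRing.scale /=; ring.
have edge y : 0 <= coord vA y -> 0 <= coord vC y ->
    coord vA y = 0 \/ coord vC y = 0 -> coord vD y = 0 -> 0 <= coord vB y <= 1 ->
    push (y, 1) = coord vB y.
  move=> a0 c0 ac d0 /andP[b0 b1].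
  by rewrite /push /= tent_on_edges // min_r // max_r.
case: xr => [[]|] [s /andP[s0 s1] <-].
- apply: edge; rewrite ?coord_segment /vA /vB /vC /vD !vertex_eq //=;
    rewrite ?mulr1 ?mulr0 ?addr0 ?add0r ?subr_ge0 ?s0 //.
  by right.
- apply: edge; rewrite ?coord_segment /vA /vB /vC /vD !vertex_eq //=;
    rewrite ?mulr1 ?mulr0 ?addr0 ?add0r ?subr_ge0 ?s0 //.
  + by left.
  + by rewrite s1 gerBl.
- rewrite push_outside.
    by rewrite coord_segment /vA /vB /vC /vD !vertex_eq //= !mulr0 addr0.
  exists false, false; rewrite !coord_segment /vA /vB /vC /vD !vertex_eq //=.
  rewrite !(mulr0, addr0) mulr_ge0 //.
  by rewrite mulr_ge0 // (le_trans ler01).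
Qed.

End Tent.

(** Moving the arc across the triangle [p 0, p 1, p 2] fixes both rails
    pointwise and carries the path to the plane where the coordinate of [p 1]
    vanishes, the plane of the three other vertices. *)
Lemma triangle_move (p : 'I_4 -> E3) (l : 'I_4 -> {linear E3 -> R^o})
    (c : 'I_4 -> R) (d : E3) (r : set E3) :
  barycentric p l c ->
  ~ bad_direction (l (inord 0) d) (l (inord 1) d) (l (inord 2) d) (l (inord 3) d) ->
  r `<=` segment (p (inord 0)) (p (inord 1)) `|` segment (p (inord 1)) (p (inord 2))
         `|` segment (p (inord 2)) (p (inord 3)) ->
  exists v m, [/\ invertible_height v m, forall x, m (x, 0) = 0,
    forall x t, line (p (inord 0)) d x -> m (x, t) = 0,
    forall x t, line (p (inord 3)) d x -> m (x, t) = 0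
  & exists2 P, plane P & shear v m 1 @` r `<=` P].
Proof.
move=> bary good rE.
have [N N1 ratio] := comparable_ratios (fun i => l i d).
have ratio' (x y : R) :
    x \in [:: l (inord 0) d; l (inord 1) d; l (inord 2) d; l (inord 3) d] ->
    y \in [:: l (inord 0) d; l (inord 1) d; l (inord 2) d; l (inord 3) d] ->
    y != 0 -> `|x| <= N * `|y|.
  by rewrite !inE => /or4P[] /eqP -> /or4P[] /eqP ->; exact: ratio.
have below := below_rails N1 ratio' good.
have on_line j i s : l i (p j + s *: d) + c i = (i == j)%:R + s * l i d.
  by rewrite -(coord_vertex bary) linearD linearZ /= /GRing.scale /=; ring.
exists (push_direction p), (push l c N); split.
- exact: invertible_height_push.
- exact: push_at_time0.
- move=> _ t [s _ <-]; apply: push_outside.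
  by rewrite !on_line !vertex_eq //= !add0r; exact: (below s).1.
- move=> _ t [s _ <-]; apply: push_outside.
  by rewrite !on_line !vertex_eq //= !add0r; exact: (below s).2.
- pose n : 'cV[R]_3 := \col_k l (inord 1) (delta_mx 0 k).
  have nE x : l (inord 1) x = (x *m n) 0 0 by apply: linear_rVE; exact: linearP.
  exists [set x | (x *m n) 0 0 = - c (inord 1)].
    exists n, (- c (inord 1)); split=> //; apply: contraTneq isT => n0.
    have := functional_sub bary (inord 1) (inord 1) (inord 0).
    rewrite nE n0 mulmx0 mxE !vertex_eq //= subr0 => /eqP.
    by rewrite eq_sym oner_eq0.
  move=> _ [x /rE xr <-] /=; rewrite -nE; apply/eqP; rewrite -addr_eq0; apply/eqP.
  exact: push_flattens.
Qed.

End TriangleMove.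

(** * Paths of three sticks *)

Section ThreeSticks.
Context (R : realType).
Local Notation E3 := 'rV[R]_3.
Implicit Types (a b d x : E3) (s t : R).

Lemma segmentC a b : segment a b = segment b a.
Proof.
suff sub a' b' : segment a' b' `<=` segment b' a' by apply/seteqP; split.
move=> _ [t /andP[t0 t1] <-]; exists (1 - t).
  by rewrite /unit_interval /= subr_ge0 t1 gerBl.
by rewrite subKr addrC.
Qed.

Lemma segment_left a b : segment a b a.
Proof.
exists 0; first by rewrite /unit_interval /= lexx ler01.
by rewrite subr0 scale1r scale0r addr0.
Qed.

Lemma segment_right a b : segment a b b.
Proof. by rewrite segmentC; exact: segment_left. Qed.

Lemma plane_segment (P : set E3) a b : plane P -> P a -> P b -> segment a b `<=` P.
Proof.
move=> [n [c [_ ->]]] /= Pa Pb _ [t _ <-] /=.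
by rewrite mulmxDl -!scalemxAl !mxE in Pa Pb *; rewrite Pa Pb; ring.
Qed.

Lemma line_rebase a d x : line a d x -> line a d = line x d.
Proof.
move=> [t _ <-]; apply/seteqP; split=> _ [s _ <-].
  by exists (s - t) => //; rewrite -addrA -scalerDl [t + _]addrC subrK.
by exists (t + s) => //; rewrite scalerDl addrA.
Qed.

Lemma barycentric_functional_sum (p : 'I_4 -> E3) l c d : barycentric p l c ->
  \sum_i l i d = 0 /\ \sum_i l i d *: p i = d.
Proof.
move=> [_ repr sum1]; split.
- have := sum1 d; have := sum1 0; under eq_bigr do rewrite linear0 add0r.
  rewrite big_split /= => c1 lc1; apply: (@addIr _ 1).
  by rewrite add0r -{1}c1.
- have := repr d; have := repr 0; under eq_bigr do rewrite linear0 add0r.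
  under [X in _ -> X = _ -> _]eq_bigr do rewrite scalerDl.
  by rewrite big_split /= => ->; rewrite addr0.
Qed.

Lemma barycentric_rev (p : 'I_4 -> E3) l c : barycentric p l c ->
  barycentric (p \o @rev_ord 4) (l \o @rev_ord 4) (c \o @rev_ord 4).
Proof.
move=> [vert repr sum1]; split=> [i j|x|x] /=.
- by rewrite vert (inj_eq rev_ord_inj).
- by rewrite -[RHS]repr [RHS](reindex_inj rev_ord_inj).
- by rewrite -[RHS](sum1 x) [RHS](reindex_inj rev_ord_inj).
Qed.

Lemma rev_inord4 k : (k < 4)%N -> rev_ord (inord k : 'I_4) = inord (3 - k).
Proof. 
by move=> k4; apply/val_inj; rewrite /= !inordK // ?ltnS ?leq_subr // subSS.
Qed.

Lemma sum_ord4 (V : nmodType) (f : 'I_4 -> V) :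
  \sum_i f i = f (inord 0) + f (inord 1) + f (inord 2) + f (inord 3).
Proof.
rewrite !big_ord_recr big_ord0 /= add0r.
by congr (_ + _ + _ + _); congr f; apply/val_inj; rewrite /= inordK.
Qed.

(** Both triangles can be obstructed only if the parallel through [p 0] or
    [p 3] meets the stick [p 1, p 2], or if the two parallels coincide. *)
Lemma good_triangle (p : 'I_4 -> E3) l c d : barycentric p l c -> d != 0 ->
  line (p (inord 0)) d <> line (p (inord 3)) d ->
  (forall x, segment (p (inord 1)) (p (inord 2)) x ->
     line (p (inord 0)) d x -> x = p (inord 0)) ->
  (forall x, segment (p (inord 1)) (p (inord 2)) x ->
     line (p (inord 3)) d x -> x = p (inord 3)) ->
  bad_direction (l (inord 0) d) (l (inord 1) d) (l (inord 2) d) (l (inord 3) d) ->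
  bad_direction (l (inord 3) d) (l (inord 2) d) (l (inord 1) d) (l (inord 0) d) ->
  False.
Proof.
move=> bary d0 l12 bc1 bc2.
have [] := barycentric_functional_sum d bary.
rewrite !sum_ord4.
move: (l _ d) (l _ d) (l _ d) (l _ d) => q3 q2 q1 q0 q_sum qE.
move: (p _) (p _) (p _) (p _) qE l12 bc1 bc2 => D C B A qE l12 bc1 bc2.
apply: one_good_direction => //.
- move=> [q10 q20]; move: q_sum qE; rewrite q10 q20 !addr0 !scale0r !addr0.
  move=> /eqP; rewrite addr_eq0 => /eqP ->.
  rewrite scaleNr addrC -scalerBr => qE.
  have q30 : q3 != 0 by apply: contraNneq d0 => q30; rewrite -qE q30 scale0r.
  apply: l12; apply: line_rebase; exists q3^-1 => //.
  by rewrite -qE scalerA mulVf // scale1r addrC subrK.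
- move=> s [s0 s1 s2 s3].
  have sBC : A + s *: d = (s * q1) *: B + (s * q2) *: C.
    rewrite -qE !scalerDr !scalerA s3 scale0r addr0 !addrA.
    by rewrite -[X in X + _ + _]/(A + _) -{1}[A]scale1r -scalerDl s0 scale0r add0r.
  have sd : A + s *: d = A.
    apply: bc1; last by exists s.
    have sq : s * q1 = 1 - s * q2 by move: q_sum s0 s3; nra.
    exists (s * q2); first by rewrite /unit_interval /= s2 -subr_ge0 -sq.
    by rewrite sBC sq.
  move/eqP: sd; rewrite -subr_eq0 addrC addKr scaler_eq0 (negPf d0) orbF => /eqP sz.
  by move: s0; rewrite sz mul0r addr0 => /eqP; rewrite oner_eq0.
- move=> s [s0 s1 s2 s3].
  have sBC : D + s *: d = (s * q1) *: B + (s * q2) *: C.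
    rewrite -qE !scalerDr !scalerA s3 scale0r add0r addrC -addrA.
    by rewrite -{2}[D]scale1r -scalerDl [s * q3 + _]addrC s0 scale0r addr0.
  have sd : D + s *: d = D.
    apply: bc2; last by exists s.
    have sq : s * q1 = 1 - s * q2 by move: q_sum s0 s3; nra.
    exists (s * q2); first by rewrite /unit_interval /= s2 -subr_ge0 -sq.
    by rewrite sBC sq.
  move/eqP: sd; rewrite -subr_eq0 addrC addKr scaler_eq0 (negPf d0) orbF => /eqP sz.
  by move: s0; rewrite sz mul0r addr0 => /eqP; rewrite oner_eq0.
Qed.

Lemma trivial_of_push (l1 l2 r r' : set E3) v m :
  rail_arc l1 l2 r' -> rail_isotopic l1 l2 r r' ->
  invertible_height v m -> (forall x, m (x, 0) = 0) ->
  (forall x t, l1 x -> m (x, t) = 0) -> (forall x t, l2 x -> m (x, t) = 0) ->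
  (exists2 P, plane P & shear v m 1 @` r' `<=` P) ->
  trivial_class (rail_arc_class l1 l2 r).
Proof.
move=> arc' iso [n mn] m0 ml1 ml2 planar; exists (shear v m 1 @` r') => //.
split; first exact: rail_arc_shear mn ml1 ml2 arc'.
exact: rail_isotopic_shear mn m0 ml1 ml2 iso.
Qed.

(** If the move across the first triangle is obstructed, the move across the
    second one is the first move for the path read backwards. *)
Lemma three_stick_path_trivial (l1 l2 r r' : set E3) (A B C D : E3) :
  rails l1 l2 -> rail_arc l1 l2 r' -> rail_isotopic l1 l2 r r' ->
  l1 A -> l2 D ->
  r' `<=` segment A B `|` segment B C `|` segment C D ->
  (forall x, segment B C x -> l1 x -> x = A) ->
  (forall x, segment B C x -> l2 x -> x = D) ->
  trivial_class (rail_arc_class l1 l2 r).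
Proof.
move=> [a [b [d [d0 l1E l2E l12]]]] arc' iso l1A l2D r'E bc1 bc2.
rewrite l1E in l1A; rewrite l2E in l2D.
rewrite (line_rebase l1A) in l1E; rewrite (line_rebase l2D) in l2E.
have [[P [Pp [PA PB PC PD]]]|indep] :=
    pselect (exists P, plane P /\ [/\ P A, P B, P C & P D]).
  exists r' => //; exists P => // x /r'E[[]|];
  exact: plane_segment.
pose p (i : 'I_4) := nth 0 [:: A; B; C; D] i.
have [pA pB pC pD] : [/\ p (inord 0) = A, p (inord 1) = B, p (inord 2) = C
    & p (inord 3) = D] by rewrite /p !inordK.
have [l [c bary]] : exists l c, barycentric p l c.
  apply: barycentric_exists => P Pp Pi; apply: indep; exists P; split=> //.
  by rewrite -pA -pB -pC -pD; split.
have [bad|good] := pselect (bad_direction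
  (l (inord 0) d) (l (inord 1) d) (l (inord 2) d) (l (inord 3) d)); last first.
  have := @triangle_move _ p l c d r' bary good.
  rewrite pA pB pC pD -l1E -l2E => /(_ r'E)[v [m [sm m0 ml1 ml2 planar]]].
  exact: (trivial_of_push arc' iso sm).
have good : ~ bad_direction
  (l (inord 3) d) (l (inord 2) d) (l (inord 1) d) (l (inord 0) d).
  move: bad; apply: good_triangle bary d0 _ _ _.
  - by rewrite pA pD -l1E -l2E.
  - by rewrite pA pB pC -l1E.
  - by rewrite pD pB pC -l2E.
have := @triangle_move _ _ _ _ d r' (barycentric_rev bary).
rewrite /= !rev_inord4 //= pA pB pC pD -l1E -l2E => /(_ good).
case=> [x /r'E[[]|]|v [m [sm m0 ml2 ml1 planar]]].
- by rewrite segmentC; right.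
- by rewrite segmentC; left; right.
- by rewrite segmentC; left; left.
exact: (trivial_of_push arc' iso sm).
Qed.

End ThreeSticks.

(** * Piecewise linear maps on the line *)

Section OneDimensional.
Context (R : realType).
Implicit Types (W : normedModType R) (s t u : R).

Lemma connected_closed_cover (T : topologicalType) (K F G : set T) :
  connected K -> closed F -> closed G -> K `<=` F `|` G ->
  K `&` F !=set0 -> K `&` G !=set0 -> K `&` F `&` G !=set0.
Proof.
move=> cK cF cG KFG KF0 [x [Kx Gx]]; apply: contrapT => disj.
have KF : K `&` F = K.
  apply: cK => //; last by exists F.
  exists (~` G); first exact: closed_openC.
  apply/seteqP; split=> y [Ky yF]; split=> //.
    by move=> Gy; apply: disj; exists y.
  by case: (KFG y Ky).
by apply: disj; exists x; rewrite KF.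
Qed.

Lemma linear_R_continuous W (L : {linear R^o -> W}) : continuous L.
Proof.
have -> : (L : R^o -> W) = fun t => t *: L 1.
  by apply/funext => t; rewrite -linearZ; congr (L _); exact: esym (mulr1 _).
by move=> t; apply: cvgZr_tmp; exact: cvg_id.
Qed.

Lemma convex_polyhedron_R_near (P : set R^o) (t : R^o) :
  convex_polyhedron P -> ~ P t -> \forall s \near t, ~ P s.
Proof.
move=> [k [phi [b ->]]] /existsNP[i /negP]; rewrite -ltNge => bt.
have nb : \forall s \near t, b i < phi i s.
  exact: cvgr_gt (@linear_R_continuous _ (phi i) t) _ bt.
by apply: filterS nb => s bs /(_ i); rewrite leNgt bs.
Qed.

Lemma convex_polyhedron_R_between (P : set R^o) (s t u : R) :
  convex_polyhedron P -> P s -> P u -> s <= t <= u -> P t.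
Proof.
move=> [k [phi [b ->]]] /= Ps Pu /andP[st tu] i.
have phiE x : phi i x = x * phi i 1.
  have -> : x * phi i 1 = phi i (x *: (1 : R^o)) by rewrite linearZ.
  by congr (phi i _); exact: esym (mulr1 _).
move: (Ps i) (Pu i); rewrite (phiE s) (phiE t) (phiE u) => ms mu.
have [m0|m0] := leP 0 (phi i 1 : R).
  by apply: le_trans mu; exact: ler_wpM2r.
by apply: le_trans ms; apply: ler_wnM2r => //; exact: ltW.
Qed.

(** The finitely many pieces near [t] which miss [t] stay away from it, being
    closed; on the others [g] is affine with the same value at [t]. *)
Lemma pl_on_R_continuous W (D : set R^o) (g : R^o -> W) :
  pl_on D g -> {within D, continuous g}.
Proof.
move=> plg; apply/subspace_continuousP => t Dt; apply/cvgrPdist_lt => eps eps0.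
have [n [P [cP aP nP]]] := plg t Dt.
have near_i i : \forall s \near t, D s -> P i s -> `|g t - g s| < eps.
  have [Pit|nPit] := pselect (P i t); last first.
    by apply: filterS (convex_polyhedron_R_near (cP i) nPit).
  have [L [c gE]] := aP i.
  have nL : \forall s \near t, `|L t - L s| < eps.
    exact: cvgr_dist_lt (@linear_R_continuous _ L t) _ eps0.
  apply: filterS nL => s Lts Ds Pis.
  by rewrite !gE // opprD addrACA subrr addr0.
have near_all : \forall s \near t, forall i, D s -> P i s -> `|g t - g s| < eps.
  by apply: (@filter_forall _ _ (fun i s => D s -> P i s -> `|g t - g s| < eps)) near_i.
rewrite near_withinE; apply: filterS2 nP near_all => s sP si Ds.
by have [i Pis] := sP Ds; exact: si Ds Pis.
Qed.

(** Of the finitely many pieces near [t], one contains [t] and a point further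
    along the ray, hence the whole segment between them. *)
Lemma pl_on_R_germ W (D : set R^o) (g : R^o -> W) (t a e0 : R) :
  pl_on D g -> 0 < e0 -> (forall s, 0 <= s <= e0 -> D (t + s * a)) ->
  exists (e : R) (q v : W), 0 < e <= e0 /\
    forall s, 0 <= s <= e -> g (t + s * a) = q + s *: v.
Proof.
move=> plg e00 De; have Dt : D t.
  by have := De 0; rewrite mul0r addr0; apply; rewrite lexx ltW.
have [n [P [cP aP nP]]] := plg t Dt.
have along (Q : set R^o) : (\forall s \near t, Q s) ->
    \forall s \near 0^'+, Q (t + s * a).
  move=> nQ; have : (t + s * a) @[s --> 0^'+] --> (t + 0 * a).
    apply: cvgD; first exact: cvg_cst.
    by apply: cvgMl; apply: cvg_at_right_filter; exact: cvg_id.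
  by rewrite mul0r addr0 => /(_ Q nQ).
have [i [Pit [s [s0 Pis]]]] :
    exists i, P i t /\ exists s, 0 < s <= e0 /\ P i (t + s * a).
  apply: contrapT => none.
  have away : \forall s \near 0^'+, forall i, ~ P i (t + s * a).
    suff away i : \forall s \near 0^'+, ~ P i (t + s * a) 
      by apply: (@filter_forall _ _ (fun i s => ~ P i (t + s * a))) away.
    have [Pit|nPit] := pselect (P i t); last first.
      exact: along (convex_polyhedron_R_near (cP i) nPit).
    near=> s => Pis; apply: none; exists i; split=> //; exists s; split=> //.
    by apply/andP; split; near: s; [exact: nbhs_right_gt|exact: nbhs_right_le].
  have [s [aws [nPs se]]] : exists s, (forall i, ~ P i (t + s * a)) /\
      (D (t + s * a) -> exists i, P i (t + s * a)) /\ 0 <= s <= e0.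
    near ((0 : R)^'+) => s; exists s; split; last split.
    - by near: s.
    - by near: s; exact: (along _ nP).
    - by apply/andP; split; near: s; [exact: nbhs_right_ge|exact: nbhs_right_le].
  by have [i /aws] := nPs (De s se).
have [L [c gE]] := aP i; exists s, (L t + c), (L a); split=> // u /andP[u0 us].
have {}s0 : 0 < s <= e0 := s0; have /andP[sp se] := s0.
have Piu : P i (t + u * a).
  have [a0|a0] := leP 0 a.
    apply: (convex_polyhedron_R_between (cP i) Pit Pis).
    by rewrite lerDl mulr_ge0 // lerD2l ler_wpM2r.
  apply: (convex_polyhedron_R_between (cP i) Pis Pit).
  apply/andP; split; first by rewrite lerD2l ler_wnM2r // ltW.
  by rewrite gerDl mulr_ge0_le0 // ltW.
rewrite gE; last by split=> //; apply: De; rewrite u0 (le_trans us).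
by rewrite linearD -[u * a]/(u *: (a : R^o)) linearZ addrAC.
Unshelve. all: by end_near. Qed.

Lemma real_induction (P : R -> Prop) : P 0 ->
  (forall t, 0 <= t < 1 -> P t ->
     exists2 u, t < u <= 1 & forall s, t < s <= u -> P s) ->
  (forall t, 0 < t <= 1 -> (forall s, 0 <= s < t -> P s) -> P t) -> P 1.
Proof.
move=> P0 Pright Pleft.
pose S := [set t : R | 0 <= t <= 1 /\ forall s, 0 <= s <= t -> P s].
have S0 : S 0.
  split; first by rewrite lexx ler01.
  by move=> s /andP[s0 s0']; have -> : s = 0 by apply/eqP; rewrite eq_le s0 s0'.
have Sub : ubound S 1 by move=> t [/andP[]].
have hS : has_sup S by split; [exists 0|exists 1].
pose u := sup S.
have u0 : 0 <= u by exact: sup_upper_bound.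
have u1 : u <= 1 by apply: ge_sup => //; exists 0.
have Pu s : 0 <= s < u -> P s.
  move=> /andP[s0 su]; have us : 0 < u - s by rewrite subr_gt0.
  have [t [_ St]] := sup_adherent us hS.
  by rewrite subKr => st; apply: St; rewrite s0 ltW.
have Pu' : P u.
  have [->//|u0'] := eqVneq u 0.
  by apply: Pleft => //; rewrite lt_neqAle eq_sym u0' u0.
have [u1E|u1'] := eqVneq u 1; first by rewrite -u1E.
have u1s : u < 1 by rewrite lt_neqAle u1' u1.
have [|v /andP[uv v1] Pv] := Pright u _ Pu'; first by rewrite u0.
suff : v <= u by rewrite leNgt uv.
apply: sup_upper_bound => //; split; first by rewrite v1 (le_trans u0) ?ltW.
move=> s /andP[s0 sv]; have [su|us|->//] := ltgtP s u; last first.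
  by apply: Pv; rewrite us.
by apply: Pu; rewrite s0.
Qed.

End OneDimensional.

(** * Arcs made of sticks *)

Section Arcs.
Context (R : realType).
Local Notation E3 := 'rV[R]_3.
Local Notation I := (@unit_interval R).
Implicit Types (a b x y : E3) (s t u : R) (g : R^o -> E3).

Lemma unit_intervalE : I = `[0, 1]%classic.
Proof. by apply/seteqP; split=> t; rewrite /unit_interval /= in_itv. Qed.

Lemma segment_path_continuous a b : continuous (fun t : R^o => (1 - t) *: a + t *: b).
Proof.
move=> t; apply: cvgD; apply: cvgZr_tmp; last exact: cvg_id.
by apply: cvgB; [exact: cvg_cst|exact: cvg_id].
Qed.

Lemma stick_connected a b : connected (segment a b).
Proof.
apply: connected_continuous_connected.
  by rewrite unit_intervalE; exact: segment_connected.
exact/continuous_subspaceT/segment_path_continuous.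
Qed.

Lemma stick_closed a b : closed (segment a b).
Proof.
apply: compact_closed; first exact: norm_hausdorff.
apply: continuous_compact.
  exact/continuous_subspaceT/segment_path_continuous.
by rewrite unit_intervalE; exact: segment_compact.
Qed.

Lemma segment_convex a b x y :
  segment a b x -> segment a b y -> segment x y `<=` segment a b.
Proof.
move=> [s /andP[s0 s1] <-] [t /andP[t0 t1] <-] _ [u /andP[u0 u1] <-].
exists ((1 - u) * s + u * t).
  by apply/andP; split; nra.
rewrite !scalerDr !scalerA [RHS]addrACA -!scalerDl.
by congr (_ *: _ + _ *: _); ring.
Qed.

Lemma arc_connected g : pl_on I g -> connected (g @` I).
Proof.
move=> plg; apply: connected_continuous_connected; last exact: pl_on_R_continuous.
by rewrite unit_intervalE; exact: segment_connected.
Qed.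

Lemma subarc_closed g s t : pl_on I g -> 0 <= s -> t <= 1 -> closed (g @` `[s, t]).
Proof.
move=> plg s0 t1; apply: compact_closed; first exact: norm_hausdorff.
apply: continuous_compact; last exact: segment_compact.
apply: continuous_subspaceW (pl_on_R_continuous plg) => u /=.
rewrite in_itv /= => /andP[su ut].
by rewrite /unit_interval /= (le_trans s0 su) (le_trans ut t1).
Qed.

(** If the arc left the segment at [t], the parts of the arc before and after
    [t] would split the segment into two disjoint closed pieces. *)
Lemma arc_meets_segment_in_interval g a b s t u :
  pl_on I g -> {in I &, injective g} -> segment a b `<=` g @` I ->
  I s -> I u -> s <= t <= u -> segment a b (g s) -> segment a b (g u) ->
  segment a b (g t).
Proof.
move=> plg injg abg /andP[s0 s1] /andP[u0 u1] /andP[st tu] abs abu.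
have t0 : 0 <= t by exact: le_trans st.
have t1 : t <= 1 by exact: le_trans tu u1.
have [x [[abx [v]]]] : segment a b `&` g @` `[0, t] `&` g @` `[t, 1] !=set0.
  apply: connected_closed_cover.
  - exact: stick_connected.
  - exact: subarc_closed.
  - exact: subarc_closed.
  - move=> _ /abg[v /andP[v0 v1] <-].
    have [vt|tv] := leP v t; [left|right]; exists v => //=.
      by rewrite in_itv /= v0.
    by rewrite in_itv /= v1 ltW.
  - by exists (g s); split=> //; exists s => //=; rewrite in_itv /= s0.
  - by exists (g u); split=> //; exists u => //=; rewrite in_itv /= tu.
rewrite /= in_itv /= => /andP[v0 vt] gv [w]; rewrite /= in_itv /= => /andP[tw w1] gw.
have vw : v = w.
  apply: injg; rewrite ?inE /unit_interval /= ?gv ?gw //.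
    by rewrite v0 (le_trans vt).
  by rewrite w1 (le_trans t0).
have -> : t = v by apply/eqP; rewrite eq_le vt andbT vw tw.
by rewrite gv.
Qed.

(** The previous lemma applies to the smaller segment from [g s] to [g u], which
    also lies in the arc. *)
Lemma subarc_in_segment g a b s t u :
  pl_on I g -> {in I &, injective g} -> segment a b `<=` g @` I ->
  I s -> I u -> segment a b (g s) -> segment a b (g u) ->
  (s <= t <= u) || (u <= t <= s) -> segment (g s) (g u) (g t).
Proof.
move=> plg injg abg Is Iu abs abu stu.
have sub : segment (g s) (g u) `<=` g @` I.
  by move=> x /(segment_convex abs abu)/abg.
case/orP: stu => stu.
  apply: (arc_meets_segment_in_interval plg injg sub Is Iu stu).
    exact: segment_left.
  exact: segment_right.
apply: (arc_meets_segment_in_interval plg injg sub Iu Is stu).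
  exact: segment_right.
exact: segment_left.
Qed.

Section Sticks.
Context (n : nat) (a b : 'I_n -> E3) (g : R^o -> E3).
Hypotheses (plg : pl_on I g) (injg : {in I &, injective g}).
Hypothesis (gE : g @` I = \bigcup_i segment (a i) (b i)).

Let meet i j t := [/\ I t, segment (a i) (b i) (g t) & segment (a j) (b j) (g t)].

(** Otherwise the stick and the union of the other ones would disconnect the
    arc. *)
Lemma stick_neighbour i t : I t -> ~ segment (a i) (b i) (g t) ->
  exists j, j != i /\ exists u, meet i j u.
Proof.
move=> It nit.
have [] : g @` I `&` segment (a i) (b i)
    `&` \bigcup_(j in [set j | j != i]) segment (a j) (b j) !=set0.
  apply: connected_closed_cover.
  - exact: arc_connected.
  - exact: stick_closed.
  - apply: closed_bigcup; first exact: finite_finset.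
    by move=> j _; exact: stick_closed.
  - rewrite gE => x [j _ jx]; have [<-|ji] := eqVneq j i; first by left.
    by right; exists j.
  - exists (a i); split; last exact: segment_left.
    by rewrite gE; exists i => //; exact: segment_left.
  - exists (g t); split; first by exists t.
    have : (g @` I) (g t) by exists t.
    rewrite gE => -[j _ jt]; exists j => //=.
    by apply: contra_notN nit => /eqP <-.
move=> x [[[u Iu <-] iu] [j ji ju]].
by exists j; split=> //; exists u.
Qed.

(** The sticks carrying the two ends of the arc each touch another stick; if
    they do not touch one another, then among three sticks that other one is
    the same for both.  Repeated indices cover the cases where fewer sticks are
    needed. *)
Lemma stick_chain : (n <= 3)%N -> exists i j k u v,
  [/\ segment (a i) (b i) (g 0), meet i j u, meet j k v & segment (a k) (b k) (g 1)].
Proof.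
move=> n3.
have I0 : I 0 by rewrite /unit_interval /= lexx ler01.
have I1 : I 1 by rewrite /unit_interval /= lexx ler01.
have on t : I t -> exists i, segment (a i) (b i) (g t).
  move=> It; have : (g @` I) (g t) by exists t.
  by rewrite gE => -[i _ it]; exists i.
have [i i0] := on 0 I0; have [k k1] := on 1 I1.
have [i1|ni1] := pselect (segment (a i) (b i) (g 1)).
  by exists i, i, i, 0, 1; split.
have [k0|nk0] := pselect (segment (a k) (b k) (g 0)).
  by exists k, k, k, 0, 1; split.
have [j [ji [u mu]]] := stick_neighbour I1 ni1.
have [j' [jk [v mv]]] := stick_neighbour I0 nk0.
have ik : i != k by apply: contra_notN ni1 => /eqP ->.
have [jkE|jk'] := eqVneq j k.
  by rewrite jkE in mu; exists i, k, k, u, 1; split.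
have [jiE|ji'] := eqVneq j' i.
  by rewrite jiE in mv; exists i, i, k, 0, v; split=> //; case: mv.
have [jjE|jj'] := eqVneq j j'.
  by rewrite -jjE in mv; exists i, j, k, u, v; split=> //; case: mv.
have /card_uniqP card4 : uniq [:: i; k; j; j'].
  by rewrite /= !inE !negb_or ik !(eq_sym i) !(eq_sym k) ji ji' jk' jk jj'.
have := max_card (mem [:: i; k; j; j']).
by rewrite card4 card_ord /= => /leq_trans/(_ n3).
Qed.

(** The contact points [g u] and [g v] serve as inner vertices.  The parameters
    [u] and [v] may come in either order: in both cases [0, u], [v, 1] and the
    interval between [u] and [v] cover the parameters. *)
Lemma three_stick_path : (n <= 3)%N -> exists B C,
  g @` I `<=` segment (g 0) B `|` segment B C `|` segment C (g 1) /\
  segment B C `<=` g @` I.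
Proof.
move=> /stick_chain[i [j [k [u [v [i0 [Iu iu ju] [Iv jv kv] k1]]]]]].
have I0 : I 0 by rewrite /unit_interval /= lexx ler01.
have I1 : I 1 by rewrite /unit_interval /= lexx ler01.
have stick h : segment (a h) (b h) `<=` g @` I by rewrite gE => x hx; exists h.
exists (g u), (g v); split; last first.
  by move=> x /(segment_convex ju jv)/stick.
move=> _ [t /andP[t0 t1] <-].
have [tu|ut] := leP t u.
  left; left; apply: (subarc_in_segment plg injg (stick i)) => //.
  by rewrite t0 tu.
have [vt|tv] := leP v t.
  right; apply: (subarc_in_segment plg injg (stick k)) => //.
  by rewrite vt t1.
left; right; apply: (subarc_in_segment plg injg (stick j)) => //.
by rewrite (ltW ut) (ltW tv).
Qed.

End Sticks.

Lemma affine_subarc g s t q v : s <= t ->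
  (forall u, s <= u <= t -> g u = q + u *: v) ->
  g @` `[s, t] = segment (g s) (g t).
Proof.
move=> st gE.
have gs : g s = q + s *: v by apply: gE; rewrite lexx.
have gt : g t = q + t *: v by apply: gE; rewrite lexx andbT.
have combine w : (1 - w) *: g s + w *: g t = q + ((1 - w) * s + w * t) *: v.
  rewrite gs gt !scalerDr addrACA -!scalerDl subrK scale1r !scalerA.
  by rewrite -scalerDl.
apply/seteqP; split=> [_ [u /= ust <-]|_ [w /andP[w0 w1] <-]].
- move: ust; rewrite in_itv /= => ust; have /andP[su ut] := ust.
  have [ts|ts] := eqVneq s t.
    have -> : u = s by apply/eqP; rewrite eq_le su ts ut.
    exact: segment_left.
  have ts0 : 0 < t - s by rewrite subr_gt0 lt_neqAle ts.
  exists ((u - s) / (t - s)).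
    by rewrite /unit_interval /= divr_ge0 ?subr_ge0 // ler_pdivrMr // mul1r lerB.
  by rewrite combine gE //; congr (_ + _ *: _); field; rewrite gt_eqF.
- exists ((1 - w) * s + w * t); last by rewrite combine gE //; nra.
  by rewrite /= in_itv /=; nra.
Qed.

Definition stick_union (sq : seq (E3 * E3)) : set E3 :=
  [set x | exists2 ab, ab \in sq & segment ab.1 ab.2 x].

(** The start is set apart because a single point is not a union of
    nondegenerate sticks. *)
Definition sticks_upto g t : Prop := t = 0 \/
  exists2 sq, all (fun ab => ab.1 != ab.2) sq & g @` `[0, t] = stick_union sq.

Lemma sticks_upto_extend g s t q v :
  {in I &, injective g} -> 0 <= s -> s < t -> t <= 1 ->
  (forall u, s <= u <= t -> g u = q + u *: v) -> sticks_upto g s -> sticks_upto g t.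
Proof.
move=> injg s0 st t1 gE Ps; right.
have gst : g s != g t.
  apply: contraTneq (st) => /injg -> //; rewrite ?ltxx // inE /unit_interval /=.
    by rewrite s0 ltW // (lt_le_trans st).
  by rewrite t1 (le_trans s0) // ltW.
have piece := affine_subarc (ltW st) gE.
have [sq dsq gsq] : exists2 sq, all (fun ab => ab.1 != ab.2) sq &
    g @` `[0, s] `<=` segment (g s) (g t) `|` stick_union sq /\
    stick_union sq `<=` g @` `[0, s].
  case: Ps => [->|[sq dsq gE0]]; last by exists sq => //; rewrite gE0; split=> // x; right.
  exists [::] => //; split; last by move=> x [ab]; rewrite in_nil.
  move=> _ [u /= + <-]; rewrite in_itv /= => /andP[u0 u0']; left.
  have -> : u = 0 by apply/eqP; rewrite eq_le u0' u0.
  exact: segment_left.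
exists ((g s, g t) :: sq) => /=; first by rewrite gst.
apply/seteqP; split=> [_ [u /= + <-]|x [ab]].
- rewrite in_itv /= => /andP[u0 ut]; have [us|su] := leP u s.
    have : (g @` `[0, s]) (g u) by exists u => //=; rewrite in_itv /= u0.
    move=> /gsq.1[stu|[ab absq abu]]; first by exists (g s, g t); rewrite ?mem_head.
    by exists ab; rewrite // in_cons absq orbT.
  exists (g s, g t); rewrite ?mem_head //= -piece.
  by exists u => //=; rewrite in_itv /= ut ltW.
- rewrite in_cons => /orP[/eqP -> /=|absq abx].
    rewrite -piece => -[u /=]; rewrite in_itv /= => /andP[su ut] <-.
    by exists u => //=; rewrite in_itv /= ut (le_trans s0).
  have [|u /= + <-] := gsq.2 x; first by exists ab.
  rewrite in_itv /= => /andP[u0 us].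
  by exists u => //=; rewrite in_itv /= u0 (le_trans us) // ltW.
Qed.

(** Real induction along the arc: an affine germ on the right of [t] lets the
    list of sticks be extended past [t], and one on the left of [t] lets it
    reach [t] from an earlier parameter. *)
Lemma arc_union_of_sticks g : pl_on I g -> {in I &, injective g} ->
  exists n, union_of_sticks n (g @` I).
Proof.
move=> plg injg.
have : sticks_upto g 1.
  apply: real_induction; first by left.
  - move=> t /andP[t0 t1] Pt.
    have [|s /andP[s0 s1]|e [q [v [/andP[e0 e1] gE]]]]  :=
      @pl_on_R_germ _ _ _ g t 1 (1 - t) plg.
    + by rewrite subr_gt0.
    + by rewrite mulr1 /unit_interval /= addr_ge0 //= -lerBrDl.
    exists (t + e); first by rewrite ltrDl e0 -lerBrDl.
    move=> s /andP[ts se].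
    apply: (@sticks_upto_extend g t s (q - t *: v) v) => //.
      by apply: (le_trans se); rewrite -lerBrDl.
    move=> u /andP[tu us]; have uE : t + (u - t) * 1 = u by ring.
    rewrite -{1}uE gE; last by rewrite subr_ge0 tu lerBlDl (le_trans us).
    by rewrite scalerBl -addrA [- _ + _]addrC.
  - move=> t /andP[t0 t1] Ps.
    have [//|s /andP[s0 s1]|e [q [v [/andP[e0 e1] gE]]]]  :=
      @pl_on_R_germ _ _ _ g t (- 1) t plg.
    + by rewrite mulrN1 /unit_interval /= subr_ge0 s1 (le_trans _ t1) // gerBl.
    apply: (@sticks_upto_extend g (t - e) t (q + t *: v) (- v)) => //.
    + by rewrite subr_ge0.
    + by rewrite gtrBl.
    + move=> u /andP[teu ut]; have uE : t + (t - u) * (- 1) = u by ring.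
      rewrite -{1}uE gE; last by rewrite subr_ge0 ut lerBlDr -lerBlDl.
      by rewrite scalerBl scalerN addrA.
    + by apply: Ps; rewrite subr_ge0 e1 gtrBl.
case=> [/eqP|[sq dsq gsq]]; first by rewrite oner_eq0.
exists (size sq), (fun i => (tnth (in_tuple sq) i).1),
  (fun i => (tnth (in_tuple sq) i).2).
split; first by move=> i; apply: (allP dsq); exact: mem_tnth.
rewrite unit_intervalE gsq; apply/seteqP; split=> x.
  move=> [ab /(nthP ab)[i isz <-] abx].
  by exists (Ordinal isz) => //; rewrite (tnth_nth ab).
by move=> [i _ ix]; exists (tnth (in_tuple sq) i) => //; exact: mem_tnth.
Qed.

End Arcs.

(** * The stick number *)

Section RailArcSticks.
Context (R : realType).
Local Notation E3 := 'rV[R]_3.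

Lemma rails_disjoint (l1 l2 : set E3) x : rails l1 l2 -> l1 x -> l2 x -> False.
Proof.
move=> [a [b [d [_ -> -> l12]]]] /line_rebase l1x /line_rebase l2x.
by apply: l12; rewrite l1x l2x.
Qed.

(** The inner stick [B C] lies in the arc, which meets each rail only in an
    endpoint; this is the condition of [three_stick_path_trivial]. *)
Lemma few_sticks_trivial (l1 l2 r r' : set E3) n :
  rails l1 l2 -> rail_arc_class l1 l2 r r' -> union_of_sticks n r' -> (n <= 3)%N ->
  trivial_class (rail_arc_class l1 l2 r).
Proof.
move=> hrails [arc' iso] [a [b [_ r'E]]] n3.
have [g [plg injg gE [g0 g1] gint]] := arc'.
rewrite gE in r'E.
have [B [C [sub BC]]] := three_stick_path plg injg r'E n3.
rewrite -gE in sub BC.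
apply: (three_stick_path_trivial hrails arc' iso g0 g1 sub) => x /BC;
  rewrite gE => -[t /andP[t0 t1] <-] lt.
- have [->//|tn0] := eqVneq t 0; have [t1E|tn1] := eqVneq t 1.
    by rewrite t1E in lt; case: (rails_disjoint hrails lt g1).
  by have [|[]] := gint t; rewrite // lt_neqAle eq_sym tn0 t0 lt_neqAle tn1.
- have [->//|tn1] := eqVneq t 1; have [t0E|tn0] := eqVneq t 0.
    by rewrite t0E in lt; case: (rails_disjoint hrails g0 lt).
  by have [|_ []] := gint t; rewrite // lt_neqAle eq_sym tn0 t0 lt_neqAle tn1.
Qed.

Lemma rail_arc_class_representable (l1 l2 r : set E3) : rail_arc l1 l2 r ->
  exists n, representable_by_sticks (rail_arc_class l1 l2 r) n.
Proof.
move=> harc; have [g [plg injg gE _ _]] := harc.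
have [n sticks] := arc_union_of_sticks plg injg.
exists n, r; last by rewrite gE.
by split=> //; exact: rail_isotopic_refl.
Qed.

End RailArcSticks.

Theorem theorem3p1 (R : realType) (l1 l2 : set 'rV[R]_3) (r : set 'rV[R]_3)
    (hrails : rails l1 l2) (harc : rail_arc l1 l2 r)
    (hnontriv : ~ trivial_class (rail_arc_class l1 l2 r)) :
  (4 <= stick_number (rail_arc_class l1 l2 r))%N.
Proof.
rewrite /stick_number; case: pselect => [h|[]]; last first.
  have [n hn] := rail_arc_class_representable harc.
  by exists n; apply/asboolP.
case: ex_minnP => n /asboolP[r' cr' sticks] _.
rewrite ltnNge; apply/negP => n3; apply: hnontriv.
exact: few_sticks_trivial hrails cr' sticks n3.
Qed.
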